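(* Let $(\mathcal{U},\mathcal{F})$ and $(\mathcal{Z},\mathcal{S})$ be measurable spaces, let $\mathbb{P}_z$ be a probability measure on $(\mathcal{Z},\mathcal{S})$, let $g:\mathcal{Z}\to\mathcal{U}$ be $(\mathcal{S},\mathcal{F})$-measurable, and let $\mathbb{P}_u := g_{\#}\mathbb{P}_z$ be the prior on $(\mathcal{U},\mathcal{F})$. Fix an observation $y$ and let $\Phi(\cdot\,;y):\mathcal{U}\to\mathbb{R}$ be an $\mathcal{F}$-measurable potential with $0<\int_{\mathcal{U}}\exp(-\Phi(u;y))\,\mathrm{d}\mathbb{P}_u(u)<\infty$. Let $\mathbb{P}_{u|y}$ be the Bayesian posterior on $\mathcal{U}$ with likelihood proportional to $\exp(-\Phi(u;y))$ and prior $\mathbb{P}_u$. Let $\mathbb{P}_{z|y}$ be the Bayesian posterior on $\mathcal{Z}$ given by $$\mathrm{d}\mathbb{P}_{z|y}(z)=\frac{1}{Z(y)}\exp(-\Phi(g(z);y))\,\mathrm{d}\mathbb{P}_z(z),$$ where $Z(y)$ is the normalizing constant. Then $$\mathbb{P}_{u|y}=g_{\#}\mathbb{P}_{z|y}.$$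
   Context: For a measurable map $g:\mathcal{Z}\to\mathcal{U}$ and a measure $\mathbb{P}$ on $(\mathcal{Z},\mathcal{S})$, the pushforward $g_{\#}\mathbb{P}$ is the measure on $(\mathcal{U},\mathcal{F})$ defined by $(g_{\#}\mathbb{P})(A)=\mathbb{P}(g^{-1}(A))$ for $A\in\mathcal{F}$. Given a prior probability measure $\mathbb{P}$ on a measurable space $\mathcal{X}$ and a likelihood proportional (as a function of $x\in\mathcal{X}$) to $\exp(-\Psi(x;y))$, the Bayesian posterior is the probability measure $A\mapsto \frac{1}{Z}\int_A \exp(-\Psi(x;y))\,\mathrm{d}\mathbb{P}(x)$ with $Z=\int_{\mathcal{X}}\exp(-\Psi(x;y))\,\mathrm{d}\mathbb{P}(x)$. *)

(* Defs.v *)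
From HB Require Import structures.
From mathcomp Require Import all_boot all_order all_algebra.
From mathcomp Require Import all_classical all_reals all_analysis.
From mathcomp Require Import measurable_realfun.
Set Implicit Arguments.
Unset Strict Implicit.
Unset Printing Implicit Defensive.
Import Order.TTheory GRing.Theory Num.Theory.
Local Open Scope classical_set_scope.
Local Open Scope ring_scope.

Section posterior.
Local Open Scope ereal_scope.
Context d (T : measurableType d) (R : realType).
Variables (P : probability T R) (Psi : T -> R).

Definition evidence : \bar R := \int[P]_x (expR (- Psi x))%:E.

(* A probability measure when 0 < evidence < +oo (instances below); a junk
   value otherwise, as 0^-1 = +oo and +oo^-1 = 0 in \bar R. *)
Definition posterior (A : set T) : \bar R :=
  evidence^-1 * \int[P]_(x in A) (expR (- Psi x))%:E.

Hypothesis mPsi : measurable_fun [set: T] Psi.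
Hypothesis evidence_gt0 : 0 < evidence.
Hypothesis evidence_lty : evidence < +oo.

Let posterior0 : posterior set0 = 0.
Proof. by rewrite /posterior integral_set0 mule0. Qed.

Let posterior_ge0 A : 0 <= posterior A.
Proof.
rewrite /posterior mule_ge0//; first by rewrite inve_ge0 ltW.
by apply: integral_ge0 => x _; rewrite lee_fin expR_ge0.
Qed.

Let posterior_sigma_additive : semi_sigma_additive posterior.
Proof.
have evf : evidence^-1 \is a fin_num.
  rewrite fin_numV ?gt_eqF//.
  by rewrite (lt_trans _ evidence_gt0)// ltNy0.
have mf : measurable_fun [set: T] (EFin \o (fun x => expR (- Psi x)%R)).
  apply/measurable_EFinP; apply: (measurableT_comp (@measurable_expR R)).
  exact: measurableT_comp.
move=> F mF tF mUF; rewrite /posterior.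
rewrite [X in X @ _ --> _](_ : _ = (fun n => evidence^-1 *
    \sum_(0 <= i < n) \int[P]_(x in F i) (expR (- Psi x))%:E)); last first.
  apply/funext => n; rewrite ge0_sume_distrr// => i _.
  by apply: integral_ge0 => x _; rewrite lee_fin expR_ge0.
apply: cvgeZl => //.
apply: (semi_sigma_additive_nng_induced mf) => // x.
by rewrite /= lee_fin expR_ge0.
Qed.

HB.instance Definition _ := isMeasure.Build _ _ _ posterior
  posterior0 posterior_ge0 posterior_sigma_additive.

Lemma posterior_setT : posterior [set: T] = 1.
Proof.
by rewrite /posterior mulVe// ?gt_eqF// ge0_fin_numE// ltW.
Qed.

HB.instance Definition _ :=
  Measure_isProbability.Build _ _ _ posterior posterior_setT.

End posterior.

(* Main.v *)
Require Import Defs.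
From mathcomp Require Import all_boot all_order all_algebra.
From mathcomp Require Import all_classical all_reals all_analysis.
From mathcomp Require Import measurable_realfun.
Set Implicit Arguments.
Unset Strict Implicit.
Unset Printing Implicit Defensive.
Local Open Scope classical_set_scope.
Local Open Scope ring_scope.

(** Integrating exp(-Phi) over D against the image measure is integrating its composite with [g]
    over the preimage of D against [Pz]. Normalization commutes with pushforward because [g] pulls
    the whole space back to the whole space. *)

Theorem lemma2p1 (R : realType) (dU dZ : measure_display)
    (U : measurableType dU) (Z : measurableType dZ) (Y : Type)
    (Pz : probability Z R) (g : {mfun Z >-> U}) (y : Y) (Phi : U -> Y -> R)
    (mPhi : measurable_fun [set: U] (fun u => Phi u y))
    (evidence_gt0 :
      (0 < \int[distribution Pz g]_u (expR (- Phi u y))%:E)%E)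
    (evidence_lty :
      (\int[distribution Pz g]_u (expR (- Phi u y))%:E < +oo)%E) :
  forall A : set U, measurable A ->
    posterior (distribution Pz g) (fun u => Phi u y) A =
    pushforward (posterior Pz (fun z => Phi (g z) y)) g A.
Proof.
(* Both the numerator and the evidence of the posterior on U are integrals
   against the pushforward of Pz, so the change of variables applies to each. *)
have transfer (D : set U) : measurable D ->
    (\int[distribution Pz g]_(u in D) (expR (- Phi u y))%:E =
     \int[Pz]_(z in g @^-1` D) (expR (- Phi (g z) y))%:E)%E.
  (* The integrand is nonnegative, so only its measurability on [D] remains. *)
  move=> mD; apply: ge0_integral_pushforward => //.
  apply: measurable_funTS; apply/measurable_EFinP.
  by apply: (measurableT_comp (@measurable_expR R)); exact: measurableT_comp.
(* [transfer] is used at [A] for the numerator and at [setT] for the evidence; the preimage of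
   [setT] is [setT] by conversion. *)
by move=> A mA; rewrite /pushforward /posterior /evidence !transfer.
Qed.
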